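(* Let $M$ be a countable set and let $\Gamma \leq \mathrm{Sym}(M)$ be a closed subgroup. Let $\mathbf{M}$ be a full structure for $\Gamma$ with universe $M$ and let $T = \mathrm{Th}(\mathbf{M})$. Then the following hold: (i) $\mathrm{S}_k(T) = \beta(M^k/\Gamma)$ for every $k \in \mathbb{N}$; (ii) $\mathbf{M}$ is an atomic model of $T$; (iii) the structure $\mathbf{M}$ is $\aleph_0$-categorical; (iv) if $\mathbf{M}$ is qf-full, then $\mathbf{M}$ is ultrahomogeneous and eliminates quantifiers.
   Context: $\mathrm{Sym}(M)$ has the topology of pointwise convergence. Signatures may be uncountable. A structure $\mathbf{M}$ with universe $M$ is full for $\Gamma$ if $\mathrm{Aut}(\mathbf{M})=\Gamma$ and for every $k\in\mathbb{N}$ every $\Gamma$-invariant subset of $M^k$ is definable in $\mathbf{M}$ by a first-order formula without parameters. It is qf-full if, moreover, every such set is definable by a quantifier-free formula without parameters. $\mathrm{Th}(\mathbf{M})$ is the set of first-order sentences true in $\mathbf{M}$. $\mathrm{S}_k(T)$ is the space of complete $k$-types of $T$ over $\emptyset$, i.e. the Stone space of the Boolean algebra of $0$-definable subsets of $M^k$. $M^k/\Gamma$ is the set of $\Gamma$-orbits on $M^k$, taken discrete, and $\beta$ denotes the Stone–Čech compactification; the equality in (i) is the natural identification coming from viewing definable sets as unions of orbits. A type is isolated if it is an isolated point of the type space; a model is atomic if it realizes only isolated types. $\mathbf{M}$ is $\aleph_0$-categorical if it is the unique countable model of its first-order theory, up to isomorphism. A structure is ultrahomogeneous if every isomorphism between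 finitely generated substructures extends to an automorphism. It eliminates quantifiers if every $0$-definable set is definable by a quantifier-free formula. *)

(* Defs.v *)
From HB Require Import structures.
From mathcomp Require Import all_boot all_classical topology.

Set Implicit Arguments.
Unset Strict Implicit.
Unset Printing Implicit Defensive.

Local Open Scope classical_set_scope.

(** * First-order logic over an arbitrary signature *)

Record signature := Signature {
  fsym : Type;
  rsym : Type;
  far : fsym -> nat;
  rar : rsym -> nat
}.

Inductive term (S : signature) (n : nat) : Type :=
| Var (i : 'I_n)
| App (f : fsym S) (ts : 'I_(far f) -> term S n).

(* [formula S n]: formulas whose free variables are among x_0, ..., x_(n-1).
   In [All p] the bound variable of [p] is x_0, and x_i becomes x_(i+1). *)
Inductive formula (S : signature) : nat -> Type :=
| Falsum n : formula S n
| Eq n (t u : term S n) : formula S n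
| Rel n (r : rsym S) (ts : 'I_(rar r) -> term S n) : formula S n
| Imp n (p q : formula S n) : formula S n
| All n (p : formula S n.+1) : formula S n.

Arguments Var {S n} i.
Arguments App {S n} f ts.
Arguments Falsum {S n}.
Arguments Eq {S n} t u.
Arguments Rel {S n} r ts.
Arguments Imp {S n} p q.
Arguments All {S n} p.

Definition Neg S n (p : formula S n) : formula S n := Imp p Falsum.

Definition And S n (p q : formula S n) : formula S n := Neg (Imp p (Neg q)).

Fixpoint quantifier_free S n (p : formula S n) : Prop :=
  match p with
  | Falsum _ | Eq _ _ _ | Rel _ _ _ => True
  | Imp _ p q => quantifier_free p /\ quantifier_free q
  | All _ _ => False
  end.

Record structure (S : signature) (M : Type) := Structure {
  finterp : forall f : fsym S, ('I_(far f) -> M) -> M;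
  rinterp : forall r : rsym S, ('I_(rar r) -> M) -> Prop
}.

Fixpoint eval S M (A : structure S M) n (a : 'I_n -> M) (t : term S n) : M :=
  match t with
  | Var i => a i
  | App f ts => finterp A (fun i => eval A a (ts i))
  end.

Definition scons M n (x : M) (a : 'I_n -> M) : 'I_n.+1 -> M :=
  fun i => oapp a x (unlift ord0 i).

Fixpoint sat S M (A : structure S M) n (p : formula S n) :
    ('I_n -> M) -> Prop :=
  match p with
  | Falsum _ => fun _ => False
  | Eq _ t u => fun a => eval A a t = eval A a u
  | Rel _ r ts => fun a => rinterp A (fun i => eval A a (ts i))
  | Imp _ p q => fun a => sat A p a -> sat A q a
  | All _ p => fun a => forall x : M, sat A p (scons x a)
  end.

Definition no_vars M (i : 'I_0) : M := False_rect M (notF (ltn_ord i)).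

Definition theory (S : signature) := set (formula S 0).

Definition models S M (A : structure S M) (T : theory S) :=
  forall p, T p -> sat A p (@no_vars M).

Definition Th S M (A : structure S M) : theory S :=
  [set p | sat A p (@no_vars M)].

Definition defset S M (A : structure S M) k (p : formula S k) :
  set ('I_k -> M) := [set a | sat A p a].

Definition definable S M (A : structure S M) k (X : set ('I_k -> M)) :=
  exists p : formula S k, X = defset A p.

Definition qf_definable S M (A : structure S M) k (X : set ('I_k -> M)) :=
  exists2 p : formula S k, quantifier_free p & X = defset A p.

Definition eliminates_quantifiers S M (A : structure S M) :=
  forall k (X : set ('I_k -> M)), definable A X -> qf_definable A X.

Definition isomorphism S M N (A : structure S M) (B : structure S N)
    (h : M -> N) :=
  [/\ bijective h,
      forall (f : fsym S) a, h (finterp A (f := f) a) = finterp B (h \o a)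
    & forall (r : rsym S) a, rinterp A (r := r) a <-> rinterp B (h \o a)].

Definition Aut S M (A : structure S M) : set (M -> M) :=
  [set g | isomorphism A A g].

Definition fclosed S M (A : structure S M) (B : set M) :=
  forall (f : fsym S) (a : 'I_(far f) -> M),
    (forall i, B (a i)) -> B (finterp A a).

Definition substructure S M (A : structure S M) (B : set M)
    (Bcl : fclosed A B) : structure S B :=
  {| finterp := fun f (a : 'I_(far f) -> B) =>
       SigSub (mem_set (Bcl f (fun i => val (a i)) (fun i => set_valP (a i))));
     rinterp := fun r (a : 'I_(rar r) -> B) =>
       rinterp A (fun i => val (a i)) |}.

Definition finitely_generated S M (A : structure S M) (B : set M) :=
  exists2 E : set M, finite_set E & B = smallest (fclosed A) E.

Definition ultrahomogeneous S M (A : structure S M) :=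
  forall (B C : set M) (Bcl : fclosed A B) (Ccl : fclosed A C),
    finitely_generated A B -> finitely_generated A C ->
    forall h : B -> C,
      isomorphism (substructure Bcl) (substructure Ccl) h ->
      exists2 g : M -> M, Aut A g & forall x : B, g (val x) = val (h x).

(* Finite models count as countable. *)
Definition aleph0_categorical S M (A : structure S M) :=
  countable [set: M] /\
  forall (N : Type) (B : structure S N), countable [set: N] ->
    models B (Th A) -> exists h : M -> N, isomorphism A B h.

(** * Spaces of types *)

Definition complete_type S (T : theory S) k (p : set (formula S k)) :=
  (exists (N : Type) (B : structure S N) (a : 'I_k -> N),
     models B T /\ forall q, p q -> sat B q a) /\
  (forall q, p q \/ p (Neg q)).

Record type_space S (T : theory S) k := CompleteType {
  type_set : set (formula S k);
  type_setP : complete_type T type_set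
}.

Lemma type_set_inj S (T : theory S) k : injective (@type_set S T k).
Proof.
move=> [p Pp] [q Pq] /= pq; case: _ / pq Pq => Pq.
by congr CompleteType; exact: Prop_irrelevance.
Qed.

Lemma complete_typeP S (T : theory S) k (p : set (formula S k)) :
  complete_type T p -> exists (N : Type) (B : structure S N) (a : 'I_k -> N),
    models B T /\ p = [set q | sat B q a].
Proof.
move=> [[N [B [a [BT Ba]]]] pC]; exists N, B, a; split=> //.
apply/seteqP; split=> q; first exact: Ba.
by move=> /= aq; case: (pC q) => // /Ba /=; tauto.
Qed.

Section TypeTopology.
Variables (S : signature) (T : theory S) (k : nat).
Local Notation S_k := (type_space T k).

HB.instance Definition _ := gen_eqMixin S_k.
HB.instance Definition _ := gen_choiceMixin S_k.

Definition type_basic (q : formula S k) : set S_k := [set p : S_k | type_set p q].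

Let basic_cover : \bigcup_(U in range type_basic) id U = setT.
Proof.
apply/seteqP; split=> // p _; exists (type_basic (Neg Falsum)).
  by exists (Neg Falsum).
have [N [B [a [_ pE]]]] := complete_typeP (type_setP p).
by rewrite /type_basic /= pE.
Qed.

Let basic_join (U V : set S_k) p : range type_basic U -> range type_basic V ->
  id U p -> id V p ->
  exists W, [/\ range type_basic W, id W p & W `<=` U `&` V].
Proof.
have andE (r : S_k) q q' : type_set r (And q q') <-> type_set r q /\ type_set r q'.
  have [N [B [a [_ ->]]]] := complete_typeP (type_setP r).
  rewrite /And /=; split; last by tauto.
  by move=> qq'; split; apply: contrapT; tauto.
move=> [q _ <-] [q' _ <-] /= pq pq'; exists (type_basic (And q q')); split.
- by exists (And q q').
- by apply/andE; split.
- by move=> r /andE.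
Qed.

HB.instance Definition _ :=
  isBaseTopological.Build S_k basic_cover basic_join.

End TypeTopology.

Definition realizes S M (A : structure S M) k (p : set (formula S k)) :=
  exists a : 'I_k -> M, p = [set q | sat A q a].

Definition atomic_model S (T : theory S) M (A : structure S M) :=
  models A T /\
  forall k (p : type_space T k),
    realizes A (type_set p) -> isolated [set: type_space T k] p.

(** * The Stone-Cech compactification of a discrete space *)

Definition homeomorphism (X Y : topologicalType) (h : X -> Y) :=
  continuous h /\
  exists h' : Y -> X, [/\ cancel h h', cancel h' h & continuous h'].

(* Ultrafilters on [X], for [X] discrete; that this is the Stone-Cech
   compactification is [beta_stone_cech]. *)
Record beta (X : Type) := Beta {
  beta_set : set_system X;
  beta_ultra : UltraFilter beta_set
}.

Lemma beta_set_inj X : injective (@beta_set X).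
Proof.
move=> [F UF] [G UG] /= FG; case: _ / FG UG => UG.
by congr Beta; exact: Prop_irrelevance.
Qed.

Section BetaTopology.
Variable X : Type.

HB.instance Definition _ := gen_eqMixin (beta X).
HB.instance Definition _ := gen_choiceMixin (beta X).

Definition beta_basic (A : set X) : set (beta X) := [set F : beta X | beta_set F A].

Let basic_cover : \bigcup_(U in range beta_basic) id U = setT.
Proof.
apply/seteqP; split=> // F _; exists (beta_basic setT); first by exists setT.
by have UF := beta_ultra F; exact: filterT.
Qed.

Let basic_join (U V : set (beta X)) F :
  range beta_basic U -> range beta_basic V ->
  id U F -> id V F ->
  exists W, [/\ range beta_basic W, id W F & W `<=` U `&` V].
Proof.
move=> [A _ <-] [B _ <-] /= FA FB; exists (beta_basic (A `&` B)); split.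
- by exists (A `&` B).
- by have UF := beta_ultra F; exact: filterI.
- by move=> G GAB; have UG := beta_ultra G; split;
    apply: filterS GAB => x [].
Qed.

HB.instance Definition _ :=
  isBaseTopological.Build (beta X) basic_cover basic_join.

End BetaTopology.

Definition stone_cech_compactification (X K : topologicalType) (i : X -> K) :=
  [/\ compact [set: K], hausdorff_space K, continuous i
    & forall (L : topologicalType) (f : X -> L),
        compact [set: L] -> hausdorff_space L -> continuous f ->
        exists! g : K -> L, continuous g /\ g \o i = f].

Definition principal X (x : X) : beta X := Beta (principal_filter_ultra x).

Section BetaStoneCech.
Variable X : choiceType.
Local Notation b := (@beta_set X).

Lemma beta_nbhs (F : beta X) (A : set X) : b F A -> nbhs F (beta_basic A).
Proof.
move=> FA; rewrite nbhsE; exists (beta_basic A) => //; split=> //.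
rewrite /open /=; exists [set beta_basic A]; first by move=> _ ->; exists A.
by rewrite bigcup_set1.
Qed.

Lemma beta_nbhsP (F : beta X) (U : set (beta X)) :
  nbhs F U -> exists2 A, b F A & beta_basic A `<=` U.
Proof.
rewrite nbhsE => -[V [[D DB <-] [W DW WF]] DU].
have [A _ AW] := DB _ DW; exists A; first by move: WF; rewrite -AW.
by move=> G GA; apply: DU; exists W => //; rewrite -AW.
Qed.

Lemma beta_disj (F : beta X) A : b F A -> b F (~` A) -> False.
Proof.
have UF := beta_ultra F => FA FnA; apply: (@filter_not_empty _ (b F)).
by rewrite -(setICr A); exact: filterI.
Qed.

Lemma principal_cvg (F : beta X) : (@principal X @ b F) --> F.
Proof.
have UF := beta_ultra F => U /beta_nbhsP[A FA AU].
by apply: filterS FA => x Ax; apply: AU; exact/principal_filterP.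
Qed.

Lemma beta_stone_cech :
  @stone_cech_compactification (discrete_topology X) (beta X)
    (@principal X).
Proof.
split.
- rewrite compact_ultra => U UU _.
  pose F := [set A | U (beta_basic A)].
  have FC A : F A \/ F (~` A).
    have [|UnA] := in_ultra_setVsetC (beta_basic A) UU; first by left.
    right; apply: filterS UnA => G nGA; have UG := beta_ultra G.
    by have [] := in_ultra_setVsetC A UG.
  have FF : ProperFilter F.
    suff FF' : Filter F.
      split=> // U0; apply: (@filter_not_empty _ U).
      apply: filterS (U0 : U (beta_basic set0)) => G G0; have UG := beta_ultra G.
      exact: (@filter_not_empty _ (b G)).
    split=> [|A B FA FB|A B AB FA].
    - by apply: (@filterE _ U) => G; have UG := beta_ultra G; exact: filterT.
    - apply: (@filterS _ U) (@filterI _ U _ _ _ FA FB) => G [GA GB].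
      by have UG := beta_ultra G; exact: filterI.
    - by apply: (@filterS _ U) FA => G; have UG := beta_ultra G; apply: filterS.
  have UF : UltraFilter F.
    split=> // G PG FG; apply/seteqP; split=> // A GA.
    have [//|/FG GnA] := FC A; exfalso; apply: (@filter_not_empty _ G).
    by rewrite -(setICr A); exact: filterI.
  exists (Beta UF); split=> // V /beta_nbhsP[A FA AV].
  exact: filterS AV FA.
- move=> F G FG; apply: beta_set_inj.
  have UF := beta_ultra F; have UG := beta_ultra G.
  apply/esym/(@max_filter _ _ UF) => A FA.
  have [//|GnA] := in_ultra_setVsetC A UG; exfalso.
  have [H [HA HnA]] := FG _ _ (beta_nbhs FA) (beta_nbhs GnA).
  exact: (beta_disj HA).
- apply/continuousP => U _; exact: discrete_open.
- move=> L f Lc Lh _.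
  have lim (F : beta X) : {l : L | (f @ b F) --> l}.
    apply: cid; have UF := beta_ultra F.
    have [|l [_ Fl]] := Lc (f @ b F) _; first exact: filterT.
    exists l => V Vl; have [//|FnV] := in_ultra_setVsetC (f @^-1` V) UF.
    have /= [|x [nVx Vx]] := Fl (~` V) V _ Vl; first exact: FnV.
    by [].
  have limU (F : beta X) (l l' : L) :
      (f @ b F) --> l -> (f @ b F) --> l' -> l = l'.
    have UF := beta_ultra F; exact: cvg_unique.
  exists (fun F => sval (lim F)); split.
    split.
      move=> F V V'.
      have [W lW WV] := @compact_regular _ _ _ Lh Lc filterT V V'.
      apply: filterS (beta_nbhs (svalP (lim F) _ lW)) => G GW.
      apply: WV; rewrite /closure /= => U GU; have UG := beta_ultra G.
      have GfU : b G (f @^-1` U) := svalP (lim G) _ GU.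
      have [x [Wx Ux]] := filter_ex (filterI GW GfU).
      by exists (f x).
    apply/funext => x; apply: limU (svalP (lim _)) _ => V /nbhs_singleton Vfx.
    exact/principal_filterP.
  move=> g [gc gf]; apply/funext => F; apply: limU (svalP (lim F)) _.
  rewrite -gf; have gF : g @ nbhs F --> g F by exact: gc.
  exact: (cvg_comp _ _ (@principal_cvg F) gF).
Qed.
End BetaStoneCech.

(** * Closed permutation groups and full structures *)

Definition Sym (M : Type) : set {ptws M -> discrete_topology {classic M}} :=
  [set g : M -> M | bijective g].
Arguments Sym : clear implicits.

Definition subgroup_Sym M (Gamma : set (M -> M)) :=
  [/\ Gamma `<=` Sym M,
      Gamma id,
      forall g h, Gamma g -> Gamma h -> Gamma (g \o h)
    & forall g h, Gamma g -> cancel g h -> cancel h g -> Gamma h].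

(* Relative to [Sym M], which is not closed in the space of all maps. *)
Definition closed_in_Sym M (Gamma : set (M -> M)) :=
  closed (Gamma : set (subspace (Sym M))).

Definition set_invariant M (Gamma : set (M -> M)) k (X : set ('I_k -> M)) :=
  forall g a, Gamma g -> X a -> X (g \o a).

Definition orbit M (Gamma : set (M -> M)) k (a : 'I_k -> M) :
  set ('I_k -> M) := [set g \o a | g in Gamma].

Definition orbits M (Gamma : set (M -> M)) k : set (set ('I_k -> M)) :=
  range (@orbit M Gamma k).
Arguments orbits {M} Gamma k.

Definition full S M (A : structure S M) (Gamma : set (M -> M)) :=
  Aut A = Gamma /\
  forall k (X : set ('I_k -> M)), set_invariant Gamma X -> definable A X.

Definition qf_full S M (A : structure S M) (Gamma : set (M -> M)) :=
  full A Gamma /\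
  forall k (X : set ('I_k -> M)), set_invariant Gamma X -> qf_definable A X.

(* The set of orbits of which a definable set is the union. *)
Definition orbits_of S M (A : structure S M) (Gamma : set (M -> M)) k
    (q : formula S k) : set (orbits Gamma k) :=
  [set O | val O `<=` defset A q].
Arguments orbits_of {S M} A Gamma {k} q.

(* Main.v *)
From mathcomp Require Import all_boot all_classical topology.
Require Import Defs.

Set Implicit Arguments.
Unset Strict Implicit.
Unset Printing Implicit Defensive.

Local Open Scope classical_set_scope.

(** Fullness makes the 0-definable subsets of [M^k] the same thing as the unions
    of [Gamma]-orbits, that is, the subsets of the discrete space [M^k/Gamma].
    Everything follows from this dictionary.

    (i) A complete type [p] is sent to the family of the sets of orbits that its
    formulas define.  As every set of orbits is defined by some formula, and as a
    valid implication between formulas passes from [A] to every model of its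
    theory, this family is an ultrafilter which determines [p].  Conversely, an
    ultrafilter [U] on the orbits is the image of a type: in the ultrapower of [A]
    along [U], Los's theorem ([Los]) says that the class of a choice of orbit
    representatives satisfies exactly the formulas whose set of orbits is in [U].
    The ultrapower takes the place of the compactness theorem, and works for a
    signature of any cardinality.  The bijection matches the basic open sets of
    the two sides, so it is a homeomorphism.

    (ii) The formula that defines the orbit of [a] isolates the type of [a].

    (iii) Let [B] be a countable model of the theory of [A].  A back-and-forth
    between [A] and [B], through pairs of tuples [a], [b] satisfying the same
    formulas, gives the isomorphism.  To go forth, name the orbit of [(x, a)] by a
    formula.  To go back, one needs that [(y, b)] satisfies the formula of the
    orbit of [(z, a)] for some [z] in [M] ([same_type_back]).  Suppose not.  These
    orbits are then infinitely many: [A] would know a finite list to be complete.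
    For every map [f] from the orbits of the [(z, a)] to themselves, the relation
    <<(v, w) lies in some such orbit O and (u, w) lies in f(O)>> is invariant,
    hence definable, and [A] knows that a [u] exists for every [v]; so [B] contains
    a [u] related to [y].  If [f] and [g] agree on only finitely many orbits, the
    same [u] cannot serve both, since then [(y, b)] would be in one of these orbits.
    As [B] is countable, a diagonal choice gives an [f] that eventually differs
    from every map served by an element of [B]: a contradiction.

    (iv) An isomorphism of finitely generated substructures preserves
    quantifier-free formulas, in particular the one that defines the orbit of a
    generating tuple.  So some element of [Gamma] has the same effect on the
    generators, and then on all of the substructure. *)

(** * First-order logic *)

Definition Ex S n (p : formula S n.+1) : formula S n := Neg (All (Neg p)).

Fixpoint forall_closure S n : formula S n -> formula S 0 :=
  if n is n'.+1 then fun p => forall_closure (All p) else id.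

Lemma sconsK M n (a : 'I_n.+1 -> M) : scons (a ord0) (a \o lift ord0) = a.
Proof. by apply/funext => i; rewrite /scons; case: unliftP => [j|] ->. Qed.

Lemma scons0 M n (x : M) (a : 'I_n -> M) : scons x a ord0 = x.
Proof. by rewrite /scons unlift_none. Qed.

Lemma sconsS M n (x : M) (a : 'I_n -> M) : scons x a \o lift ord0 = a.
Proof. by apply/funext => i; rewrite /scons /= liftK. Qed.

Lemma scons_comp M N (g : M -> N) n (x : M) (a : 'I_n -> M) :
  g \o scons x a = scons (g x) (g \o a).
Proof. by apply/funext => i; rewrite /scons /=; case: unlift. Qed.

Lemma no_vars_eq M (a : 'I_0 -> M) : a = @no_vars M.
Proof. by apply/funext => -[]. Qed.

Section Satisfaction.
Context {S : signature} {M : Type} {A : structure S M}.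

Lemma sat_And n (p q : formula S n) a :
  sat A (And p q) a <-> sat A p a /\ sat A q a.
Proof. by split=> /= [h|]; [split; apply: contrapT|]; tauto. Qed.

Lemma sat_Ex n (p : formula S n.+1) a :
  sat A (Ex p) a <-> exists x, sat A p (scons x a).
Proof.
split=> /= [|[x px] /(_ x)//]; apply: contra_notP => np x px.
by apply: np; exists x.
Qed.

Lemma sat_forall_closure n (p : formula S n) :
  sat A (forall_closure p) (@no_vars M) <-> forall a, sat A p a.
Proof.
elim: n p => [|n IHn] p /=; first by split=> // h a; rewrite (no_vars_eq a).
rewrite IHn /=; split=> [h a|//]; rewrite -(sconsK a); exact: h.
Qed.

End Satisfaction.

Section Isomorphisms.
Context {S : signature} {M N : Type} {A : structure S M} {B : structure S N}.

Lemma eval_isomorphism (h : M -> N) n (a : 'I_n -> M) (t : term S n) :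
  isomorphism A B h -> eval B (h \o a) t = h (eval A a t).
Proof.
move=> [_ hf _]; elim: t => [//|f ts IH] /=; rewrite hf; congr finterp.
by apply/funext => i /=; rewrite IH.
Qed.

Lemma sat_isomorphism (h : M -> N) n (p : formula S n) :
  isomorphism A B h -> forall a, sat A p a <-> sat B p (h \o a).
Proof.
move=> hI; have [[h' hK h'K] _ hr] := hI.
elim: {n} p => [n|n t u|n r ts|n p IHp q IHq|n p IHp] a //=.
- by rewrite !(eval_isomorphism _ _ hI); split=> [->|/(can_inj hK)].
- rewrite hr; suff -> : h \o (fun i => eval A a (ts i)) =
    (fun i => eval B (h \o a) (ts i)) by exact: iff_refl.
  by apply/funext => i; rewrite (eval_isomorphism _ _ hI).
- by have := IHp a; have := IHq a; tauto.
- split=> [pa y|pa x]; last by apply/IHp; rewrite scons_comp.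
  by rewrite -(h'K y) -scons_comp; apply/IHp.
Qed.

End Isomorphisms.

Section Theories.
Context {S : signature} {M N : Type} {A : structure S M} {B : structure S N}.
Hypothesis BA : models B (Th A).

Lemma sat_sentence (p : formula S 0) :
  sat A p (@no_vars M) <-> sat B p (@no_vars N).
Proof.
split=> [/BA//|pB]; apply: contrapT => npA.
have /BA : Th A (Neg p) by [].
exact.
Qed.

(** Being a model is a condition on sentences; through universal closures it
    also carries over the inclusions between the definable subsets of [A]. *)
Lemma valid_transfer n (p : formula S n) :
  (forall a, sat A p a) -> forall b, sat B p b.
Proof. by move=> /sat_forall_closure/sat_sentence/sat_forall_closure. Qed.

End Theories.

(** * Ultrapowers *)

Section Ultrapower.
Context {S : signature} {M : Type} (A : structure S M).
Context {I : Type} (U : set_system I).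
Hypothesis UU : UltraFilter U.

Let germ_of (f : I -> M) : set (I -> M) :=
  [set g | U [set i | f i = g i]].

(** Elements of the ultrapower are the classes themselves, as sets of functions;
    operations are computed on chosen representatives. *)
Definition germ : Type := {X : set (I -> M) | exists f, X = germ_of f}.

Let germ_inj (x y : germ) : sval x = sval y -> x = y.
Proof.
case: x y => [X p] [Y q] /= e; case: _ / e q => q.
by congr exist; exact: Prop_irrelevance.
Qed.

Definition to_germ (f : I -> M) : germ :=
  exist _ (germ_of f) (ex_intro _ f erefl).

Definition germ_repr (x : germ) : I -> M := sval (cid (svalP x)).

Lemma germ_reprK x : to_germ (germ_repr x) = x.
Proof.
apply: germ_inj; rewrite /germ_repr /=; case: cid => /= f.
by case: x => X /= _ ->.
Qed.

Lemma to_germP f g : to_germ f = to_germ g <-> U [set i | f i = g i].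
Proof.
split=> [/(congr1 sval)/= fg|fg].
  have : germ_of g g by apply: filterE.
  by rewrite -fg.
apply: germ_inj; apply/seteqP; split=> h /= fh.
  by apply: filterS2 fg fh => i /= -> ->.
by apply: filterS2 fg fh => i /= -> ->.
Qed.

Lemma germ_repr_near f : U [set i | germ_repr (to_germ f) i = f i].
Proof. by apply/to_germP; rewrite germ_reprK. Qed.

Definition ultrapower : structure S germ := {|
  finterp f a := to_germ (fun i => finterp A (fun j => germ_repr (a j) i));
  rinterp r a := U [set i | rinterp A (fun j => germ_repr (a j) i)] |}.

(** An ultrafilter is closed under finite intersections, so finitely many
    representatives are simultaneously the expected ones on a large set; this is
    where the finiteness of arities enters. *)
Lemma germ_repr_family k (a : 'I_k -> I -> M) :
  U [set i | (fun j => germ_repr (to_germ (a j)) i) = a ^~ i].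
Proof.
have : U [set i | forall j, germ_repr (to_germ (a j)) i = a j i].
  by apply: filter_forall => j; exact: germ_repr_near.
by apply: filterS => i h; apply/funext.
Qed.

Lemma eval_ultrapower n (a : 'I_n -> I -> M) (t : term S n) :
  eval ultrapower (to_germ \o a) t = to_germ (fun i => eval A (a ^~ i) t).
Proof.
elim: t => [//|f ts IH].
transitivity (finterp ultrapower
    (fun j => to_germ (fun i => eval A (a ^~ i) (ts j)))).
  by congr (@finterp _ _ ultrapower f _); apply/funext => j; exact: IH.
apply/to_germP.
by apply: filterS (germ_repr_family (fun j i => eval A (a ^~ i) (ts j))) => i /= ->.
Qed.

Lemma ultra_imp (P Q : set I) : (U P -> U Q) <-> U (~` P `|` Q).
Proof.
split=> [PQ|PQ UP].
  have [/PQ|] := in_ultra_setVsetC P UU; apply: filterS => i; by [left|right].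
by apply: filterS2 PQ UP => i [].
Qed.

(** The step for [All] is where choice is used: if the universal formula failed on
    a large set of indices, counterexamples chosen index by index would form one
    element of the ultrapower at which it fails. *)
Lemma Los n (p : formula S n) (a : 'I_n -> I -> M) :
  sat ultrapower p (to_germ \o a) <-> U [set i | sat A p (a ^~ i)].
Proof.
elim: {n} p a => [n|n t u|n r ts|n p IHp q IHq|n p IHp] a /=.
- by split=> // /filter_ex[].
- by rewrite !eval_ultrapower to_germP.
- have rE : U [set i |
      (fun j => germ_repr (eval ultrapower (to_germ \o a) (ts j)) i) =
      (fun j => eval A (a ^~ i) (ts j))].
    apply: filterS (germ_repr_family (fun j i => eval A (a ^~ i) (ts j))).
    by move=> i /= <-; apply/funext => j; rewrite eval_ultrapower.
  by split; apply: filterS2 rE => i /= ->.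
- rewrite IHp IHq ultra_imp; split; apply: filterS => i /=.
    by case.
  by move=> pq; have [/pq|] := pselect (sat A p (a ^~ i)); [right|left].
- have sconsE f i : scons f a ^~ i = scons (f i) (a ^~ i).
    by rewrite -(scons_comp (fun g : I -> M => g i)).
  split=> [pa|pa x].
    have [//|npa] := in_ultra_setVsetC [set i | sat A (All p) (a ^~ i)] UU.
    (* [x0] is only a default value, at the indices without counterexample. *)
    exfalso; have [i0 /existsNP[x0 _]] := filter_ex npa.
    have /choice[f fP] i : exists x,
        ~ sat A (All p) (a ^~ i) -> ~ sat A p (scons x (a ^~ i)).
      have [?|/existsNP[x npx]] := pselect (sat A (All p) (a ^~ i)).
        by exists x0.
      by exists x.
    have := pa (to_germ f); rewrite -scons_comp => /IHp pf.
    have [i [/fP]] := filter_ex (filterI npa pf).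
    by rewrite /= sconsE.
  rewrite -(germ_reprK x) -scons_comp IHp; apply: filterS pa => i /=.
  by rewrite sconsE; exact.
Qed.

Lemma ultrapower_Th : models ultrapower (Th A).
Proof.
move=> p pA; rewrite -(no_vars_eq (to_germ \o @no_vars _)) Los.
by apply: filterE => i /=; rewrite [X in sat A p X]no_vars_eq.
Qed.

End Ultrapower.
(** * The topology of type spaces *)

Lemma ultrafilter_of_setC X (F : set_system X) :
  ProperFilter F -> (forall P, F P \/ F (~` P)) -> UltraFilter F.
Proof.
move=> PF FC; split=> // G PG FG; apply/seteqP; split=> // P GP.
have [//|/FG GnP] := FC P; exfalso; apply: (@filter_not_empty _ G).
by rewrite -(setICr P); exact: filterI.
Qed.

Section TypeSpace.
Context {S : signature} (T : theory S) {k : nat}.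
Implicit Type p : type_space T k.

Lemma type_nbhs p q : type_set p q -> nbhs p (@type_basic S T k q).
Proof.
move=> pq; rewrite nbhsE; exists (type_basic q) => //; split=> //.
rewrite /open /=; exists [set type_basic q]; first by move=> _ ->; exists q.
by rewrite bigcup_set1.
Qed.

Lemma type_nbhsP p (V : set (type_space T k)) :
  nbhs p V -> exists2 q, type_set p q & @type_basic S T k q `<=` V.
Proof.
rewrite nbhsE => -[W [[D DB <-] [X DX Xp]] DV].
have [q _ qX] := DB _ DX; exists q; first by move: Xp; rewrite -qX.
by move=> r rq; apply: DV; exists X => //; rewrite -qX.
Qed.

End TypeSpace.

Section Types.
Context {S : signature} {M : Type} {A : structure S M} {k : nat}.
Implicit Type p : type_space (Th A) k.

Lemma type_entail p (q r : formula S k) :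
  defset A q `<=` defset A r -> type_set p q -> type_set p r.
Proof.
move=> qr; have [N [B [b [BA ->]]]] := complete_typeP (type_setP p).
exact: (valid_transfer (p := Imp q r) BA qr b).
Qed.

Lemma type_valid p (q : formula S k) : defset A q = setT -> type_set p q.
Proof.
move=> qT; have [N [B [b [BA ->]]]] := complete_typeP (type_setP p).
by apply: (valid_transfer BA) => a; rewrite -[sat _ _ _]/(defset A q a) qT.
Qed.

Lemma type_And p (q r : formula S k) :
  type_set p (And q r) <-> type_set p q /\ type_set p r.
Proof.
have [N [B [b [_ ->]]]] := complete_typeP (type_setP p); exact: sat_And.
Qed.

Lemma type_Neg p (q : formula S k) : type_set p (Neg q) <-> ~ type_set p q.
Proof. by have [N [B [b [_ ->]]]] := complete_typeP (type_setP p). Qed.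

(** A type containing [q] contains all of [p], and a complete type contained in
    another one is equal to it. *)
Lemma isolated_type p (q : formula S k) :
  type_set p q -> (forall r, type_set p r -> defset A q `<=` defset A r) ->
  isolated [set: type_space (Th A) k] p.
Proof.
move=> pq qE; split; first by rewrite in_setT.
exists (type_basic q); first exact: type_nbhs.
rewrite setIT; apply/seteqP; split=> [s sq|_ ->//].
apply: type_set_inj; apply/seteqP; split=> r.
  move=> sr; apply: contrapT => /type_Neg npr.
  have /type_Neg : type_set s (Neg r) by apply: type_entail sq; exact: qE.
  exact.
by move=> pr; apply: type_entail sq; exact: qE.
Qed.

End Types.

(** The topologies of a type space and of [beta X] are generated by the sets of
    points containing a given formula, or a given subset; a bijection that matches
    the two families is a homeomorphism. *)
Lemma homeomorphism_basic S (T : theory S) k (X : choiceType)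
    (h : type_space T k -> beta X) (D : formula S k -> set X) :
  bijective h -> (forall Y, exists q, D q = Y) ->
  (forall p q, beta_set (h p) (D q) <-> type_set p q) -> homeomorphism h.
Proof.
move=> [h' hK h'K] Dsurj hD; split.
  move=> p U /beta_nbhsP[Y]; have [q <- {Y}] := Dsurj Y.
  move=> /hD pq qU; apply: filterS (type_nbhs pq) => s sq.
  by apply: qU; exact/hD.
exists h'; split=> // F U /type_nbhsP[q].
rewrite -hD h'K => Fq qU; apply: filterS (beta_nbhs Fq) => G Gq.
by apply: qU; rewrite /type_basic /= -hD h'K.
Qed.
(** * Orbits and definable sets *)

Section Orbits.
Context {M : Type} {Gamma : set (M -> M)}.
Hypothesis GS : subgroup_Sym Gamma.

Lemma orbit_refl k (a : 'I_k -> M) : orbit Gamma a a.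
Proof. by case: GS => _ G1 _ _; exists id. Qed.

Lemma orbit_invariant k (a : 'I_k -> M) : set_invariant Gamma (orbit Gamma a).
Proof.
case: GS => _ _ GM _ g _ Gg [f Gf <-].
by exists (g \o f); [exact: GM|].
Qed.

Lemma orbit_sub k (X : set ('I_k -> M)) a :
  set_invariant Gamma X -> X a -> orbit Gamma a `<=` X.
Proof. by move=> GX Xa _ [g Gg <-]; exact: GX. Qed.

Lemma orbit_sym k (a b : 'I_k -> M) : orbit Gamma a b -> orbit Gamma b a.
Proof.
case: GS => GSym _ _ GV [g Gg <-]; have [g' gK g'K] := GSym g Gg.
exists g'; first exact: GV gK g'K.
by apply/funext => i /=; rewrite gK.
Qed.

Lemma orbit_eq k (a b : 'I_k -> M) :
  orbit Gamma a b -> orbit Gamma a = orbit Gamma b.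
Proof.
move=> ab; apply/seteqP; split; apply: orbit_sub (@orbit_invariant _ _) _ => //.
exact: orbit_sym.
Qed.

Lemma orbit_representative k (O : orbits Gamma k) :
  exists a, val O = orbit Gamma a.
Proof. by have [a _ <-] := set_valP O; exists a. Qed.

Definition to_orbit k (a : 'I_k -> M) : orbits Gamma k :=
  SigSub (mem_set (imageT (@orbit M Gamma k) a)).

End Orbits.

Section Full.
Context {S : signature} {M : Type} {A : structure S M} {Gamma : set (M -> M)}.
Hypothesis GS : subgroup_Sym Gamma.
Hypothesis AG : full A Gamma.

Lemma defset_invariant k (q : formula S k) : set_invariant Gamma (defset A q).
Proof.
by case: AG => <- _ g a /= /(sat_isomorphism q)/(_ a)[+ _]; exact.
Qed.

(** Definable sets are invariant, hence contain an orbit as soon as they meet it. *)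
Lemma orbits_ofE k (q : formula S k) (O : orbits Gamma k) a :
  val O = orbit Gamma a -> orbits_of A Gamma q O <-> sat A q a.
Proof.
rewrite /orbits_of /= => ->; split; first by apply; exact: orbit_refl.
by apply: orbit_sub; exact: defset_invariant.
Qed.

Lemma orbits_of_sub k (q r : formula S k) :
  orbits_of A Gamma q `<=` orbits_of A Gamma r -> defset A q `<=` defset A r.
Proof.
move=> qr a qa; apply/(@orbits_ofE _ r (to_orbit a) a erefl).
by apply: qr; exact/(@orbits_ofE _ q (to_orbit a) a erefl).
Qed.

(** This is fullness, seen on the orbit space. *)
Lemma orbits_of_surj k (Y : set (orbits Gamma k)) :
  exists q : formula S k, orbits_of A Gamma q = Y.
Proof.
have [q qE] : definable A [set a | exists2 O, Y O & val O a].
  case: AG => _; apply=> g a Gg [O YO Oa]; exists O => //.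
  have [b Ob] := orbit_representative O; rewrite Ob in Oa *.
  exact: orbit_invariant.
exists q; apply/seteqP; split=> O; last first.
  by move=> YO a Oa; rewrite -qE; exists O.
have [a Oa] := orbit_representative O.
move=> /(orbits_ofE _ Oa); rewrite -[sat _ _ _]/(defset A q a) -qE => -[O' YO' O'a].
suff -> : O = O' by [].
apply/val_inj; rewrite Oa; have [a' O'a'] := orbit_representative O'.
by rewrite O'a' in O'a *; apply/esym; exact: orbit_eq.
Qed.

Lemma orbits_of_type k (p : type_space (Th A) k) (q : formula S k) :
  [set orbits_of A Gamma r | r in type_set p] (orbits_of A Gamma q) <->
  type_set p q.
Proof.
split=> [[r pr rq]|pq]; last by exists q.
by apply: type_entail pr; apply: orbits_of_sub; rewrite rq.
Qed.

Lemma orbits_of_type_ultra k (p : type_space (Th A) k) :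
  UltraFilter [set orbits_of A Gamma q | q in type_set p].
Proof.
set F := [set _ | _ in _].
have FE q : F (orbits_of A Gamma q) <-> type_set p q by exact: orbits_of_type.
have CE (q : formula S k) : ~` orbits_of A Gamma q = orbits_of A Gamma (Neg q).
  apply/seteqP; split=> O; have [a Oa] := orbit_representative O;
    by rewrite /setC /= !(orbits_ofE _ Oa).
apply: ultrafilter_of_setC => [|Y]; last first.
  have [q <-] := orbits_of_surj Y; rewrite CE !FE type_Neg; exact: EM.
split.
  have [q q0] := orbits_of_surj (set0 : set (orbits Gamma k)); rewrite -q0 FE => pq.
  have /type_Neg : type_set p (Neg q); last exact.
  apply: type_entail pq; apply: orbits_of_sub; rewrite q0; exact: sub0set.
split=> [|Y Z|Y Z YZ].
- exists (Neg Falsum); first by apply: type_valid; apply/seteqP; split=> // a _ [].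
  by apply/seteqP; split=> // O _ a _.
- have [q <-] := orbits_of_surj Y; have [r <-] := orbits_of_surj Z.
  rewrite !FE => pq pr; have : type_set p (And q r) by rewrite type_And.
  move=> /FE; congr (F _); apply/seteqP.
  by split=> O; have [a Oa] := orbit_representative O;
     rewrite /setI /= !(orbits_ofE _ Oa) sat_And.
- have [q qY] := orbits_of_surj Y; have [r rZ] := orbits_of_surj Z.
  rewrite -qY -rZ !FE; apply: type_entail; apply: orbits_of_sub.
  by rewrite qY rZ.
Qed.

(** For surjectivity, a function choosing a representative of each orbit is a
    tuple of the ultrapower, whose type corresponds to the given ultrafilter. *)
Lemma types_beta k :
  exists h : type_space (Th A) k -> beta (orbits Gamma k),
    homeomorphism h /\
    forall p, beta_set (h p) = [set orbits_of A Gamma q | q in type_set p].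
Proof.
pose h p := Beta (@orbits_of_type_ultra k p).
exists h; split=> //.
apply: (@homeomorphism_basic _ _ _ _ h (@orbits_of _ _ A Gamma k)); last first.
- exact: orbits_of_type.
- exact: orbits_of_surj.
have hI : injective h.
  move=> p p' /(congr1 (@beta_set _))/= pp'; apply: type_set_inj.
  have pE q : type_set p q <-> type_set p' q by rewrite -!orbits_of_type pp'.
  by apply/seteqP; split=> q /pE.
have hS F : exists p, h p = F.
  have UF := beta_ultra F.
  pose a i (O : orbits Gamma k) := sval (cid (orbit_representative O)) i.
  have aE (O : orbits Gamma k) : val O = orbit Gamma (a ^~ O).
    exact: svalP (cid (orbit_representative O)).
  pose B := ultrapower A (beta_set F).
  pose b := @to_germ M (orbits Gamma k) (beta_set F) \o a.
  have pC : complete_type (Th A) [set q | sat B q b].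
    split=> [|q]; last exact: EM.
    by exists _, B, b; split=> //; exact: ultrapower_Th.
  exists (CompleteType pC); apply: beta_set_inj; apply/seteqP.
  have bE (q : formula S k) : sat B q b <-> beta_set F (orbits_of A Gamma q).
    rewrite Los; suff -> : [set O | sat A q (a ^~ O)] = orbits_of A Gamma q by [].
    by apply/seteqP; split=> O; rewrite (orbits_ofE _ (aE O)).
  split=> [_ [q /= qb <-]|Y]; first exact/bE.
  by have [q <-] := orbits_of_surj Y => /bE; exists q.
have [h' h'K] := choice hS.
exists h' => // p; exact: hI.
Qed.

Lemma full_atomic : atomic_model (Th A) A.
Proof.
split=> [//|k p [a pa]].
have [q qE] : definable A (orbit Gamma a).
  by case: AG => _; apply; exact: orbit_invariant.
apply: (@isolated_type _ _ _ _ _ q); rewrite pa.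
  by rewrite /= -[sat _ _ _]/(defset A q a) -qE; exact: orbit_refl.
move=> r /= ra; rewrite -qE; apply: orbit_sub => //; exact: defset_invariant.
Qed.

End Full.
(** * Countable models of the theory *)

(** The representative is chosen from the value [T x] alone. *)
Lemma canonical_representatives X Y (T : X -> Y) : exists rep : X -> X,
  (forall x, T (rep x) = T x) /\ (forall x x', T x = T x' -> rep x = rep x').
Proof.
pose F y (e : exists x, T x = y) := sval (cid e).
have Feq y y' (e : exists x, T x = y) (e' : exists x, T x = y') :
    y = y' -> F y e = F y' e'.
  by move=> yy'; case: _ / yy' e' => e'; congr F; exact: Prop_irrelevance.
exists (fun x => F (T x) (ex_intro _ x erefl)); split=> [x|x x' xx'].
  by rewrite /F; case: cid.
exact: Feq.
Qed.

Lemma bounded_on_initial_segment N (c : N -> nat) (w : N -> nat) n :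
  injective c -> exists m, forall u, c u < n -> w u < m.
Proof.
move=> cI; elim: n => [|n [m mP]]; first by exists 0.
have [[u0 u0n]|no] := pselect (exists u, c u = n).
  exists (maxn m (w u0).+1) => u; rewrite ltnS leq_eqVlt => /predU1P[un|/mP um].
    by rewrite (cI u u0) ?leq_maxr// un.
  exact: leq_trans um (leq_maxl _ _).
exists m => u; rewrite ltnS leq_eqVlt => /predU1P[un|/mP//].
by exfalso; apply: no; exists u.
Qed.

Definition same_type S M N (A : structure S M) (B : structure S N) k
    (a : 'I_k -> M) (b : 'I_k -> N) :=
  forall q : formula S k, sat A q a <-> sat B q b.

Section Extension.
Context {S : signature} {M N : Type} {A : structure S M} {B : structure S N}.
Context {Gamma : set (M -> M)}.
Hypothesis GS : subgroup_Sym Gamma.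
Hypothesis AG : full A Gamma.
Context {k : nat} {a : 'I_k -> M} {b : 'I_k -> N}.
Hypothesis ab : same_type A B a b.

Lemma same_type_All (q : formula S k.+1) :
  (forall x, sat A q (scons x a)) -> forall y, sat B q (scons y b).
Proof. exact: (ab (All q)).1. Qed.

(** A formula that defines an orbit implies every formula true on it. *)
Lemma same_type_scons (q : formula S k.+1) x y :
  orbit Gamma (scons x a) = defset A q -> sat B q (scons y b) ->
  same_type A B (scons x a) (scons y b).
Proof.
move=> qE qy; have imp r : sat A r (scons x a) -> sat B r (scons y b).
  move=> rx; apply: (same_type_All (q := Imp q r)) qy => z /=.
  rewrite -[sat _ _ _]/(defset A q _) -qE.
  exact: (orbit_sub (@defset_invariant _ _ _ _ AG _ r) rx).
move=> r; split; first exact: imp.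
by move=> ry; apply: contrapT => /(imp (Neg r))/(_ ry).
Qed.

Lemma same_type_forth x : exists y, same_type A B (scons x a) (scons y b).
Proof.
have [q qE] : definable A (orbit Gamma (scons x a)).
  by case: AG => _; apply; exact: orbit_invariant.
have /ab/sat_Ex[y qy] : sat A (Ex q) a.
  apply/sat_Ex; exists x; rewrite -[sat _ _ _]/(defset A q _) -qE.
  exact: orbit_refl.
by exists y; exact: same_type_scons qy.
Qed.

(** The diagonal argument.  Were [(y, b)] in none of the orbits [T z] of [(z, a)],
    then every map between these orbits would require a witness in [B], and maps
    that are eventually different would require different ones. *)
Lemma same_type_back (cM : M -> nat) (cN : N -> nat) (y : N) :
  injective cM -> injective cN ->
  exists x, same_type A B (scons x a) (scons y b).
Proof.
move=> cMI cNI; have [AutA def] := AG.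
pose T z := orbit Gamma (scons z a).
have Tinv z : set_invariant Gamma (T z) by exact: orbit_invariant.
have TE z t : T z t -> orbit Gamma t = T z by move=> /(orbit_eq GS)/esym.
have Tself z : T z (scons z a) by exact: orbit_refl.
have /choice[phi phiE] z : definable A (T z) by exact: def.
apply: contrapT => nox.
have nphi z : ~ sat B (phi z) (scons y b).
  by move=> zy; apply: nox; exists z; exact: same_type_scons (phiE z) zy.
(* [V n] is the union of the first orbits.  It consists of at most [n] of them, so
   [B] cannot put [(y, b)] in it without putting it in one of them. *)
pose V n := [set t | exists2 z, cM z < n & T z t].
have Vdef n : definable A (V n).
  by apply: def => g t Gg [z zn zt]; exists z => //; exact: Tinv.
have nV n (q : formula S k.+1) : V n = defset A q -> ~ sat B q (scons y b).
  elim: n q => [|n IHn] q qE.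
    apply: (same_type_All (q := Neg q)) => z /=.
    by rewrite -[sat _ _ _]/(defset A q _) -qE => -[].
  have [q' q'E] := Vdef n.
  have [[z zn]|no] := pselect (exists z, cM z = n).
    move=> qy; apply: (nphi z).
    apply: (same_type_All (q := Imp q (Imp (Neg q') (phi z)))) (IHn _ q'E) => //.
    move=> v /=; rewrite -[sat _ q _]/(defset A q _) -qE.
    rewrite -[sat _ q' _]/(defset A q' _) -q'E -[sat _ _ _]/(defset A _ _) -phiE.
    move=> -[z' z'n z'v] nVv; move: z'n; rewrite ltnS leq_eqVlt => /predU1P[|z'n].
      by rewrite -zn => /cMI <-.
    by exfalso; apply: nVv; exists z'.
  apply: IHn; rewrite -qE; apply/seteqP; split=> t [z zn zt]; exists z => //.
    exact: ltnW.
  move: zn; rewrite ltnS leq_eqVlt => /predU1P[zn|//].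
  by exfalso; apply: no; exists z.
(* Maps between orbits are encoded as maps [M -> M], read through canonical
   representatives so that equality of values means equality of orbits. *)
have [rep [Trep repT]] := canonical_representatives T.
have unbounded n : exists z, n <= cM (rep z).
  apply: contrapT => /forallNP bd; have [q qE] := Vdef n; apply: (nV _ _ qE).
  apply: same_type_All => z; rewrite -[sat _ _ _]/(defset A q _) -qE.
  exists (rep z); first by rewrite ltnNge; apply/negP.
  by rewrite Trep.
pose R (f : M -> M) := [set t : 'I_k.+2 -> M | exists z, T z (t \o lift ord0) /\
  T (f (rep z)) (scons (t ord0) (t \o lift ord0 \o lift ord0))].
have /choice[rho rhoE] f : definable A (R f).
  apply: def => g t Gg [z [zt ft]]; exists z; split; first exact: (Tinv z g _ Gg zt).
  by rewrite /= -[X in scons _ X]/(g \o _) -scons_comp; exact: Tinv.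
have rhoP f u v :
    sat A (rho f) (scons u (scons v a)) <->
    exists z, T z (scons v a) /\ T (f (rep z)) (scons u a).
  rewrite -[sat _ _ _]/(defset A _ _) -rhoE /R /=.
  by rewrite scons0 !sconsS.
have rho_ex f : exists u, sat B (rho f) (scons u (scons y b)).
  apply/(sat_Ex (rho f)); apply: same_type_All => v.
  apply/(sat_Ex (rho f)); exists (f (rep v)).
  by apply/rhoP; exists v.
(* Each [u] in [N] is the witness for some map [g u], or for no map at all; the
   maps for which it is the witness are almost equal, so one of them is enough. *)
have /choice[g gP] u : exists g, forall f,
    sat B (rho f) (scons u (scons y b)) -> sat B (rho g) (scons u (scons y b)).
  have [[g gu]|no] := pselect (exists g, sat B (rho g) (scons u (scons y b))).
    by exists g.
  by exists id => f fu; exfalso; apply: no; exists f.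
(* The diagonal: [f] avoids at [z] the values at [z] of the maps [g u], for the
   finitely many [u] whose code is at most that of [z].  So [f] and [g u] agree
   only at orbits with a code below [cN u], that is, inside [V (cN u)]. *)
have /choice[f fP] z :
    exists x, forall u, cN u <= cM z -> cM (rep (g u z)) < cM (rep x).
  have [m mP] :=
    bounded_on_initial_segment (fun u => cM (rep (g u z))) (cM z).+1 cNI.
  have [x mx] := unbounded m; exists x => u uz.
  exact: leq_trans (mP u uz) mx.
have [u fu] := rho_ex f; have gu := gP u f fu.
have [q qE] := Vdef (cN u); apply: (nV _ _ qE).
have fgu : sat B (Ex (And (rho f) (rho (g u)))) (scons y b).
  by apply/sat_Ex; exists u; exact/sat_And.
suff fgq v :
    sat A (Ex (And (rho f) (rho (g u)))) (scons v a) -> sat A q (scons v a).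
  exact: (same_type_All (q := Imp (Ex (And (rho f) (rho (g u)))) q)) fgu.
move=> /sat_Ex[u' /sat_And[/rhoP[z [zv fz]] /rhoP[z' [z'v gz']]]].
have zz' : rep z = rep z' by apply: repT; rewrite -(TE _ _ zv) (TE _ _ z'v).
rewrite -zz' in gz'.
have fg : rep (f (rep z)) = rep (g u (rep z)).
  by apply: repT; rewrite -(TE _ _ fz) (TE _ _ gz').
rewrite -[sat _ _ _]/(defset A q _) -qE; exists (rep z); last by rewrite Trep.
by rewrite ltnNge; apply/negP => /fP; rewrite fg ltnn.
Qed.

End Extension.

(** The graph of [h] is the union of an increasing chain of pairs of tuples related
    by [E], in which stage [n] takes in the elements with code [n] of both sides.
    The second conclusion records that finitely many values of [h] always appear
    together at one stage; it is what transfers to [h] any property that [E] has of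
    finite tuples. *)
Lemma back_and_forth M N (E : forall k, ('I_k -> M) -> ('I_k -> N) -> Prop)
    (cM : M -> nat) (cN : N -> nat) :
  injective cM -> injective cN ->
  (exists a b, E 0 a b) ->
  (forall k a b i j, E k a b -> a i = a j <-> b i = b j) ->
  (forall k a b, E k a b -> forall x, exists y, E k.+1 (scons x a) (scons y b)) ->
  (forall k a b, E k a b -> forall y, exists x, E k.+1 (scons x a) (scons y b)) ->
  exists2 h : M -> N, bijective h &
    forall n (e : 'I_n -> M), exists k (a : 'I_k -> M) (j : 'I_n -> 'I_k),
      E k a (h \o a) /\ e = a \o j.
Proof.
move=> cMI cNI [a0 [b0 ab0]] Einj forth back.
pose St := {k & {ab : ('I_k -> M) * ('I_k -> N) | E k ab.1 ab.2}}.
pose st k a b (ab : E k a b) : St := existT _ k (exist _ (a, b) ab).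
pose left (s : St) : 'I_(projT1 s) -> M := (sval (projT2 s)).1.
pose right (s : St) : 'I_(projT1 s) -> N := (sval (projT2 s)).2.
have StE s : E _ (left s) (right s) by case: s => k [].
pose ext s s' := exists j, left s = left s' \o j /\ right s = right s' \o j.
have ext_refl s : ext s s by exists id.
have ext_trans s s' s'' : ext s s' -> ext s' s'' -> ext s s''.
  move=> [j [lj rj]] [j' [lj' rj']]; exists (j' \o j).
  by rewrite lj rj lj' rj'.
have ext_scons k a b (ab : E k a b) x y (ab' : E k.+1 (scons x a) (scons y b)) :
    ext (st _ _ _ ab) (st _ _ _ ab').
  by exists (lift ord0); rewrite /left /right /= !sconsS.
have extl s n : exists s', ext s s' /\
    forall x, cM x = n -> exists i, left s' i = x.
  have [[x xn]|no] := pselect (exists x, cM x = n); last first.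
    by exists s; split=> // x xn; exfalso; apply: no; exists x.
  case: s => k [[a b] /= ab]; have [y ab'] := forth _ _ _ ab x.
  exists (st _ _ _ ab'); split; first exact: (ext_scons _ _ _ ab).
  by move=> x' x'n; exists ord0; rewrite /left /= scons0; apply: cMI; rewrite xn.
have extr s n : exists s', ext s s' /\
    forall y, cN y = n -> exists i, right s' i = y.
  have [[y yn]|no] := pselect (exists y, cN y = n); last first.
    by exists s; split=> // y yn; exfalso; apply: no; exists y.
  case: s => k [[a b] /= ab]; have [x ab'] := back _ _ _ ab y.
  exists (st _ _ _ ab'); split; first exact: (ext_scons _ _ _ ab).
  by move=> y' y'n; exists ord0; rewrite /right /= scons0; apply: cNI; rewrite yn.
have /choice[next nextP] (sn : St * nat) : exists s', [/\ ext sn.1 s',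
    forall x, cM x = sn.2 -> exists i, left s' i = x
  & forall y, cN y = sn.2 -> exists i, right s' i = y].
  case: sn => s n /=; have [s1 [ss1 s1P]] := extl s n.
  have [s2 [[j [j1 j2]] s2P]] := extr s1 n; exists s2; split=> //.
    by apply: ext_trans ss1 _; exists j.
  by move=> x /s1P[i <-]; exists (j i); rewrite j1.
pose fix s n : St := if n is n'.+1 then next (s n', n') else st _ _ _ ab0.
have s_mono m n : m <= n -> ext (s m) (s n).
  elim: n => [|n IHn]; first by rewrite leqn0 => /eqP->.
  rewrite leq_eqVlt => /predU1P[->//|/IHn mn]; apply: ext_trans mn _.
  by case: (nextP (s n, n)).
have sl x : exists i, left (s (cM x).+1) i = x.
  by case: (nextP (s (cM x), cM x)) => _ + _; exact.
have sr y : exists i, right (s (cN y).+1) i = y.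
  by case: (nextP (s (cN y), cN y)) => _ _; exact.
have s_fun m n i j :
    left (s m) i = left (s n) j <-> right (s m) i = right (s n) j.
  have [jm [-> ->]] := s_mono _ _ (leq_maxl m n).
  have [jn [-> ->]] := s_mono _ _ (leq_maxr m n).
  exact: Einj (StE _).
have /choice[h hP] x : exists y, exists n i, left (s n) i = x /\ right (s n) i = y.
  by have [i ix] := sl x; exists (right (s (cM x).+1) i), (cM x).+1, i.
have hE n i : h (left (s n) i) = right (s n) i.
  by have [m [j [ji <-]]] := hP (left (s n) i); apply/s_fun.
have /choice[h' h'K] y : exists x, h x = y.
  by have [i iy] := sr y; exists (left (s (cN y).+1) i); rewrite hE.
exists h.
  exists h' => // x; have [i <-] := sl x; have [j jy] := sr (h (left _ i)).
  have [n [l [ln lr]]] := hP (h' (h (left (s (cM x).+1) i))).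
  by rewrite -ln; apply/s_fun; rewrite lr h'K hE.
move=> n e; pose m := \max_(i < n) (cM (e i)).+1.
have /choice[j jP] (i : 'I_n) : exists j, left (s m) j = e i.
  have [l le] := sl (e i).
  have [j [jl _]] := s_mono _ _ (leq_bigmax (F := fun i => (cM (e i)).+1) i).
  by exists (j l); rewrite -[LHS]/((left _ \o j) l) -jl.
exists _, (left (s m)), j; split; last by apply/funext => i /=; rewrite jP.
have -> : h \o left (s m) = right (s m) by apply/funext => i /=; rewrite hE.
exact: StE.
Qed.

Lemma countable_inj X : countable [set: X] -> exists c : X -> nat, injective c.
Proof.
by move=> /countable_injP[c cI]; exists c => x x' /cI; apply; rewrite in_setT.
Qed.

(** With [E] the relation of satisfying the same formulas, atomic formulas alone
    make [h] injective and compatible with the signature. *)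
Lemma full_aleph0_categorical S M (A : structure S M) (Gamma : set (M -> M)) :
  countable [set: M] -> subgroup_Sym Gamma -> full A Gamma ->
  aleph0_categorical A.
Proof.
move=> Mc GS AG; split=> // N B Nc BA.
have [cM cMI] := countable_inj Mc; have [cN cNI] := countable_inj Nc.
have [||||h hbij hE] :=
  back_and_forth (E := fun k a b => same_type A B a b) cMI cNI.
- by exists (@no_vars M), (@no_vars N) => q; exact: sat_sentence.
- by move=> k a b i j /(_ (Eq (Var i) (Var j))).
- by move=> k a b ab x; exact: (same_type_forth GS AG).
- by move=> k a b ab y; exact: (same_type_back GS AG ab y cMI cNI).
exists h; split=> // [f|r] e.
  (* With the value next to the arguments, in one tuple of the chain, the
     graph of [f] at [e] is described by an equation. *)
  have [k [a [j [ab ej]]]] := hE _ (scons (finterp A e) e).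
  have aj : a \o j \o lift ord0 = e by rewrite -ej sconsS.
  have aj0 : a (j ord0) = finterp A e.
    by rewrite -[LHS]/((a \o j) ord0) -ej scons0.
  rewrite -aj0; apply/esym; rewrite -aj.
  apply: (ab (Eq (App f (fun i => Var (j (lift ord0 i)))) (Var (j ord0)))).1.
  by rewrite /= aj0 -aj.
have [k [a [j [ab ->]]]] := hE _ e.
exact: (ab (Rel r (fun i => Var (j i)))).
Qed.

(** * Ultrahomogeneity *)

Section QuantifierFree.
Context {S : signature} {M : Type} {A : structure S M}.

Lemma eval_substructure (B : set M) (Bcl : fclosed A B) n (t : term S n)
    (a : 'I_n -> B) :
  val (eval (substructure Bcl) a t) = eval A (val \o a) t.
Proof.
elim: t => [//|f ts IH] /=; congr (finterp A _).
by apply/funext => i; exact: IH.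
Qed.

Lemma sat_substructure (B : set M) (Bcl : fclosed A B) n (p : formula S n) :
  quantifier_free p -> forall a : 'I_n -> B,
  sat (substructure Bcl) p a <-> sat A p (val \o a).
Proof.
elim: {n} p => [n|n t u|n r ts|n p IHp q IHq|n p IHp] //=.
- by move=> _ a; rewrite -!(eval_substructure Bcl); split=> [->|/val_inj].
- move=> _ a.
  suff -> : (fun i => val (eval (substructure Bcl) a (ts i))) =
    (fun i => eval A (val \o a) (ts i)) by [].
  by apply/funext => i; exact: eval_substructure.
- by move=> [/IHp{}IHp /IHq{}IHq] a; have := IHp a; have := IHq a; tauto.
Qed.

End QuantifierFree.
Lemma finite_set_family X (E : set X) :
  finite_set E -> exists n (e : 'I_n -> X), E = range e.
Proof.
move=> /(@finite_seqP {classic X})[s ->].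
exists (size s), (tnth (in_tuple s)); apply/seteqP; split=> [x /= xs|_ [i _ <-]].
  by have /tnthP[i ->] : x \in in_tuple s by []; exists i.
exact: mem_tnth.
Qed.

Lemma qf_full_ultrahomogeneous S M (A : structure S M) (Gamma : set (M -> M)) :
  subgroup_Sym Gamma -> qf_full A Gamma -> ultrahomogeneous A.
Proof.
move=> GS [[AutA _] qf] B C Bcl Ccl [E Efin BE] _ h hI.
have [n [e eE]] := finite_set_family Efin.
have eB i : e i \in B.
  by rewrite in_setE BE; apply: sub_gen_smallest; rewrite eE; exists i.
pose b i : B := SigSub (eB i).
have be : val \o b = e by apply/funext.
have [p pqf pE] := qf _ _ (orbit_invariant GS (a := e)).
have [g Gg gh] : orbit Gamma e (val \o (h \o b)).
  rewrite pE; apply/(sat_substructure Ccl pqf)/(sat_isomorphism p hI).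
  apply/(sat_substructure Bcl pqf); rewrite be -[sat _ _ _]/(defset A p e) -pE.
  exact: orbit_refl.
have Ag : Aut A g by rewrite AutA.
exists g => // x.
(* Where [g] and [h] agree is closed under the operations. *)
suff : B `<=` [set y | exists2 x' : B, val x' = y & g y = val (h x')].
  by move=> /(_ _ (set_valP x))[x' /val_inj->].
rewrite {1}BE; apply: smallest_sub => [f a aP|].
  have /choice[y yP] i : exists x', val x' = a i /\ g (a i) = val (h x').
    by have [x'] := aP i; exists x'.
  exists (finterp (substructure Bcl) y).
    by congr (finterp A _); apply/funext => i; case: (yP i).
  have [_ hf _] := hI; have [_ gf _] := Ag.
  rewrite gf hf; congr (finterp A _); apply/funext => i /=.
  by case: (yP i) => _ ->.
rewrite eE => _ [i _ <-]; exists (b i) => //.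
by rewrite -[LHS]/((g \o e) i) gh.
Qed.

Lemma qf_full_eliminates_quantifiers S M (A : structure S M)
    (Gamma : set (M -> M)) :
  qf_full A Gamma -> eliminates_quantifiers A.
Proof.
move=> [AG qf] k X [p ->]; apply: qf; exact: defset_invariant.
Qed.

Theorem theorem3p3 (M : Type) (Gamma : set (M -> M))
    (S : signature) (A : structure S M) :
  countable [set: M] ->
  subgroup_Sym Gamma ->
  closed_in_Sym Gamma ->
  full A Gamma ->
  [/\ forall k : nat,
        exists h : type_space (Th A) k -> beta (orbits Gamma k),
          homeomorphism h /\
          forall p, beta_set (h p) =
            [set orbits_of A Gamma q | q in type_set p],
      atomic_model (Th A) A,
      aleph0_categorical A
    & qf_full A Gamma -> ultrahomogeneous A /\ eliminates_quantifiers A].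
Proof.
move=> Mc GS _ AG; split.
- by move=> k; exact: types_beta.
- exact: full_atomic AG.
- exact: full_aleph0_categorical AG.
move=> qAG; split; first exact: qf_full_ultrahomogeneous GS qAG.
exact: qf_full_eliminates_quantifiers qAG.
Qed.
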